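(* There is a function $\varepsilon(n)$ with $\varepsilon(n)\to 0$ as $n\to\infty$ such that for every positive integer $n$ there exists a cobipartite graph $G$ on $n$ vertices with $\mathrm{lcc}(G)>\frac{1}{4}(1-\varepsilon(n))\frac{n}{\log n}$.
   Context: A graph is cobipartite if its complement is bipartite. A clique covering of a graph $G$ is a family $\mathcal{C}$ of cliques of $G$ such that every edge of $G$ is contained in at least one clique of $\mathcal{C}$; it is a $k$-clique covering if every vertex belongs to at most $k$ cliques of $\mathcal{C}$. $\mathrm{lcc}(G)$ is the smallest $k$ such that $G$ admits a $k$-clique covering. Logarithms are base $2$. *)

(* Defs.v *)
From HB Require Import structures.
From mathcomp Require Import all_boot all_order all_algebra.
From mathcomp Require Import all_classical all_reals all_analysis.
Set Implicit Arguments.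
Unset Strict Implicit.
Unset Printing Implicit Defensive.
Import Order.TTheory GRing.Theory Num.Theory.

Record sgraph (T : finType) := SGraph {
  adj : rel T;
  adj_sym : symmetric adj;
  adj_irr : irreflexive adj }.

Section Graph.
Variable T : finType.
Implicit Types (G : sgraph T) (K : {set T}) (C : {set {set T}}).

Definition cadj G : rel T := fun u v => (u != v) && ~~ adj G u v.

Lemma cadj_sym G : symmetric (cadj G).
Proof. by move=> u v; rewrite /cadj eq_sym adj_sym. Qed.

Lemma cadj_irr G : irreflexive (cadj G).
Proof. by move=> u; rewrite /cadj eqxx. Qed.

Definition compl_graph G : sgraph T := SGraph (cadj_sym G) (cadj_irr G).

(* [A] and its complement are the two sides; either may be empty. *)
Definition bipartite G : bool :=
  [exists A : {set T}, forall u, forall v,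
     adj G u v ==> ((u \in A) != (v \in A))].

Definition cobipartite G : bool := bipartite (compl_graph G).

(* The empty set and the singletons are cliques. *)
Definition clique G K : bool :=
  [forall u in K, forall v in K, (u != v) ==> adj G u v].

Definition clique_covering G C : bool :=
  [forall K in C, clique G K] &&
  [forall u, forall v, adj G u v ==> [exists K in C, (u \in K) && (v \in K)]].

Definition k_clique_covering (k : nat) G C : bool :=
  clique_covering G C && [forall u, #|[set K in C | u \in K]| <= k].

Lemma ex_k_clique_covering G :
  exists k, [exists C, k_clique_covering k G C].
Proof.
exists #|{set T}|; apply/existsP; exists [set K | clique G K].
apply/andP; split; last by apply/forallP => u; exact: max_card.
apply/andP; split; first by apply/forall_inP => K; rewrite inE.
apply/forallP => u; apply/forallP => v; apply/implyP => uv.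
apply/exists_inP; exists [set u; v]; last by rewrite !inE !eqxx orbT.
rewrite inE; apply/forall_inP => x /set2P xuv.
apply/forall_inP => y /set2P yuv; apply/implyP.
by case: xuv => ->; case: yuv => ->; rewrite ?eqxx // adj_sym.
Qed.

Definition lcc G : nat := ex_minn (ex_k_clique_covering G).

End Graph.

Local Open Scope ring_scope.

Definition log2 (R : realType) (x : R) : R := ln x / ln 2.

(* Main.v *)
(** Fix a balanced vertex bipartition [(A, ~: A)]; the cobipartite graphs in which
    both sides are cliques correspond to the [2 ^ (#|A| * #|~: A|)] sets of cross
    edges. A [k]-clique covering has at most [n * k] nonempty cliques, and the
    family of the sets of at most [k] cliques containing each vertex determines
    the graph. If all these graphs have [lcc <= k], the number of such families
    gives [2 ^ (n ^ 2 / 4)] up to a constant [<= (e * n) ^ (k * n)], and taking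
    logarithms bounds [k] from below. *)
Require Import Defs.
From mathcomp Require Import all_boot all_order all_algebra.
From mathcomp Require Import all_classical all_reals all_analysis.
From mathcomp Require Import zify ring lra.
Import Order.TTheory GRing.Theory Num.Theory.
Import numFieldNormedType.Exports.

(** Testing both orders makes the relation symmetric for arbitrary [E], so the graphs carry no side
    condition on [E]. *)
Definition cross_adj (T : finType) (A : {set T}) (E : {set T * T}) : rel T :=
  fun u v => (u != v) &&
    [|| (u \in A) == (v \in A), (u, v) \in E | (v, u) \in E].

Lemma cross_adj_sym (T : finType) (A : {set T}) (E : {set T * T}) :
  symmetric (cross_adj T A E).
Proof.
by move=> u v; rewrite /cross_adj eq_sym (eq_sym (u \in A)) [X in _ || X]orbC.
Qed.

Lemma cross_adj_irr (T : finType) (A : {set T}) (E : {set T * T}) :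
  irreflexive (cross_adj T A E).
Proof. by move=> u; rewrite /cross_adj eqxx. Qed.

Definition cross_graph (T : finType) (A : {set T}) (E : {set T * T}) :=
  SGraph (@cross_adj_sym T A E) (@cross_adj_irr T A E).

Lemma cross_graph_cobipartite (T : finType) (A : {set T}) (E : {set T * T}) :
  cobipartite (cross_graph T A E).
Proof.
apply/existsP; exists A; apply/forallP => u; apply/forallP => v.
apply/implyP => /andP[uv]; rewrite /= /cross_adj uv /= negb_or.
by case/andP.
Qed.

Lemma cross_graphE (T : finType) (A : {set T}) (E : {set T * T}) u v :
  E \subset finset.setX A (~: A) -> u \in A -> v \notin A ->
  adj (cross_graph T A E) u v = ((u, v) \in E).
Proof.
move=> /fintype.subsetP sE uA vA /=; rewrite /cross_adj uA (negbTE vA) /=.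
have -> /= : u != v by apply: contraNneq vA => <-.
suff -> : ((v, u) \in E) = false by rewrite orbF.
by apply/negP => /sE; rewrite inE /= (negbTE vA).
Qed.

(* The labels of [u] are the positions, in an enumeration of the nonempty
   cliques, of those containing [u]. *)
Lemma lcc_labelling (T : finType) (G : sgraph T) (k : nat) : (lcc G <= k)%N ->
  exists f : {ffun T -> {set 'I_(#|T| * k)}},
    (forall u, (#|f u| <= k)%N) /\
    (forall u v, u != v -> adj G u v = (f u :&: f v != finset.set0)).
Proof.
rewrite /lcc; case: ex_minnP => l /existsP[C /andP[/andP[/forall_inP cliC covC]
  /forallP degC]] _ lk.
pose D := [set K in C | K != finset.set0].
have degD u : (#|[set K in D | u \in K]| <= k)%N.
  apply: leq_trans lk; apply: leq_trans (degC u).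
  by apply/subset_leq_card/fintype.subsetP => K; rewrite !inE -andbA => /and3P[-> _ ->].
(* Double counting of incidences between vertices and members of [D]: each member, being nonempty,
   has at least one, and each vertex has at most [k]. *)
have cardD : (#|D| <= #|T| * k)%N.
  apply: (@leq_trans (\sum_(K in D) #|K|)).
    rewrite -sum1_card; apply: leq_sum => K.
    by rewrite !inE card_gt0 => /andP[].
  under eq_bigr do rewrite -sum1_card.
  rewrite (exchange_big_dep predT) //= -sum_nat_const.
  apply: leq_sum => u _; apply: leq_trans (degD u).
  by rewrite -sum1_card; apply/eq_leq/eq_bigl => K; rewrite !inE.
(* [D] may have fewer than [#|T| * k] members; with the empty default, a surplus index is never a
   label of any vertex. *)
pose lab i := nth finset.set0 (enum D) i.
have lab_lt i u : u \in lab i -> (i < size (enum D))%N.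
  by apply: contraTT; rewrite -leqNgt => h; rewrite /lab nth_default // inE.
have lab_in i u : u \in lab i -> lab i \in D.
  by move=> /lab_lt h; rewrite -mem_enum mem_nth.
exists [ffun u => [set i : 'I_(#|T| * k) | u \in lab i]]; split=> [u|u v uv].
  rewrite ffunE; apply: leq_trans (degD u).
  rewrite -(@card_in_imset _ _ (fun i : 'I_(#|T| * k) => lab i)).
    apply/subset_leq_card/fintype.subsetP => K /imsetP[i]; rewrite inE => ui ->.
    by rewrite inE (lab_in _ _ ui).
  move=> i j; rewrite !inE => /lab_lt ui /lab_lt uj /eqP.
  by rewrite nth_uniq ?enum_uniq // => /eqP/val_inj.
rewrite !ffunE; apply/idP/set0Pn => [Guv|[i]].
  move/forallP/(_ u)/forallP/(_ v)/implyP/(_ Guv)/exists_inP: covC.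
  move=> [K KC /andP[uK vK]].
  have KD : K \in enum D.
    by rewrite mem_enum inE KC; apply/set0Pn; exists u.
  have iK : (index K (enum D) < #|T| * k)%N.
    by apply: leq_trans cardD; rewrite cardE index_mem.
  by exists (Ordinal iK); rewrite !inE /lab /= nth_index // uK.
rewrite !inE => /andP[ui vi].
have := lab_in _ _ ui; rewrite inE => /andP[/cliC /forall_inP/(_ u ui) + _].
by move=> /forall_inP/(_ v vi)/implyP; apply.
Qed.

(** A labelling recovers [E] inside [A] times its complement, as the set of cross pairs whose labels
    meet. So the image under [cross] of the labellings with values in [S] contains every subset of
    that product. *)
Lemma cross_graph_count (T : finType) (A : {set T}) (k : nat) :
  (forall E, (lcc (cross_graph T A E) <= k)%N) ->
  (2 ^ (#|A| * #|~: A|) <=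
   #|[set X : {set 'I_(#|T| * k)} | (#|X| <= k)%N]| ^ #|T|)%N.
Proof.
move=> lccA; rewrite -cardsX -card_powerset.
pose S := [set X : {set 'I_(#|T| * k)} | (#|X| <= k)%N].
pose cross (f : {ffun T -> {set 'I_(#|T| * k)}}) :=
  [set p in finset.setX A (~: A) | f p.1 :&: f p.2 != finset.set0].
rewrite -(card_ffun_on T (mem S)).
apply: leq_trans (leq_imset_card cross _).
apply/subset_leq_card/fintype.subsetP => E; rewrite inE => sE.
have [f [fk fE]] := @lcc_labelling _ _ _ (lccA E).
apply/imsetP; exists f; first by apply/ffun_onP => u; rewrite inE.
apply/setP => -[u v]; rewrite !inE /=.
have [/andP[uA vA]|nX] := boolP ((u \in A) && _).
  rewrite -fE ?cross_graphE //; by apply: contraNneq vA => <-.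
by apply: contraNF nX => /(fintype.subsetP sE); rewrite !inE.
Qed.

Local Open Scope ring_scope.

(* Weighting a set [X] by [x ^+ #|X|] makes the total weight [(1 + x) ^+ #|I|],
   while the sets counted weigh at least [x ^+ k]. *)
Lemma card_small_sets (R : realFieldType) (I : finType) (k : nat) (x : R) :
  0 <= x <= 1 ->
  #|[set X : {set I} | (#|X| <= k)%N]|%:R * x ^+ k <= (1 + x) ^+ #|I|.
Proof.
move=> /andP[x0 x1]; rewrite addrC -prodr_const bigA_distr /=.
have wt (X : {set I}) : \prod_i (if i \in X then x else 1) = x ^+ #|X|.
  by rewrite -big_mkcond prodr_const.
under eq_bigr do rewrite wt.
rewrite mulr_natl -sumr_const big_mkcond /=.
apply: ler_sum => X _; rewrite inE; case: ifP => [Xk|_].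
  by rewrite ler_wiXn2l.
by rewrite exprn_ge0.
Qed.

(** The weight [x = 1 / n] gives the bound [n ^ k * (1 + 1 / n) ^ (n * k)], and
    [1 + 1 / n <= expR (1 / n)]. *)
Lemma card_small_sets_expR (R : realType) (n k : nat) : (0 < n)%N ->
  #|[set X : {set 'I_(n * k)} | (#|X| <= k)%N]|%:R <= (n%:R * expR 1) ^+ k :> R.
Proof.
move=> n0; have nR : 0 < n%:R :> R by rewrite ltr0n.
have x01 : 0 <= (n%:R^-1 : R) <= 1.
  by rewrite invr_ge0 ltW //= invf_le1 // ler1n.
have := @card_small_sets R 'I_(n * k) k _ x01.
rewrite card_ord exprVn ler_pdivrMr ?exprn_gt0 // => /le_trans; apply.
have y0 : 0 <= 1 + n%:R^-1 :> R by rewrite addr_ge0 ?invr_ge0.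
rewrite exprMn mulrC ler_wpM2l ?exprn_ge0 // exprM.
rewrite lerXn2r ?nnegrE ?exprn_ge0 ?expR_ge0 //.
rewrite -[X in expR X](@divff _ n%:R) ?gt_eqF // expRM_natl.
by rewrite lerXn2r ?nnegrE ?expR_ge0 ?expR_ge1Dx.
Qed.

(** A set of [n./2] elements works; the [+ 1] is the exact loss for odd [n]. *)
Lemma balanced_set (n : nat) :
  exists A : {set 'I_n}, (n ^ 2 <= 4 * (#|A| * #|~: A|) + 1)%N.
Proof.
have /card_geqP[s [us ss _]] : (n./2 <= #|'I_n|)%N by rewrite card_ord; lia.
have cA : #|[set:: s]| = n./2 by rewrite finset.cardsE (card_uniqP us).
have := finset.cardsC [set:: s]; rewrite cA card_ord => hC.
exists [set:: s]; rewrite cA; have := odd_double_half n; move: hC.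
move: (n./2) #|~: _| (nat_of_bool _) (leq_b1 (odd n)) => h b r r1 + E.
rewrite -{}E -addnn => hb; have -> : b = (r + h)%N by lia.
rewrite -mulnn; nia.
Qed.

Lemma lcc_lower_bound (R : realType) (n : nat) : (0 < n)%N ->
  exists G : sgraph 'I_n, cobipartite G /\
    (n%:R ^+ 2 - 1) * ln 2 <= 4 * (lcc G)%:R * n%:R * (1 + ln n%:R) :> R.
Proof.
move=> n0; have nR : 0 < n%:R :> R by rewrite ltr0n.
have [A hA] := balanced_set n.
have e0 : 0 < n%:R * expR 1 :> R by rewrite mulr_gt0 ?expR_gt0.
pose F E := lcc (cross_graph _ A E).
(* The worst [E] is the witness: taking its [lcc] as [k] bounds the [lcc] of all the cross graphs,
   as [cross_graph_count] requires. *)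
have [E FE] : {E | (\max_E F E)%N = F E}.
  by apply: bigop.eq_bigmax; apply/card_gt0P; exists finset.set0.
exists (cross_graph _ A E); split; first exact: cross_graph_cobipartite.
have /cross_graph_count : forall E', (lcc (cross_graph _ A E') <= F E)%N.
  by move=> E'; rewrite -FE (bigop.leq_bigmax E').
rewrite card_ord; set p := (#|A| * _)%N in hA *; rewrite -/(F E).
move: (F E) => k; rewrite -(ler_nat R) !natrX => cnt.
have {}cnt : 2 ^+ p <= ((n%:R * expR 1) ^+ k) ^+ n :> R.
  apply: le_trans cnt _; rewrite lerXn2r ?nnegrE ?ler0n ?(ltW (exprn_gt0 _ _)) //.
  exact: card_small_sets_expR.
move: cnt; rewrite -ler_ln ?posrE ?exprn_gt0 //.
rewrite (lnXn _ (exprn_gt0 k e0)) (lnXn k e0) (lnXn p (ltr0n R 2)).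
rewrite -(mulr_natl (_ *+ _) n) -!(mulr_natl (ln _)).
rewrite lnM ?posrE ?expR_gt0 // expRK => cnt.
have ln2 : 0 <= ln 2 :> R by rewrite ln_ge0 // ler1n.
move: hA; rewrite -(ler_nat R) natrX natrD natrM => hA.
apply: (@le_trans _ _ (4 * (p%:R * ln 2))); first by rewrite mulrA ler_wpM2r // lerBlDr.
by rewrite -!mulrA ler_pM2l // mulrCA (addrC 1).
Qed.

Local Open Scope classical_set_scope.
Local Open Scope ring_scope.

Lemma cvg_ln_nat (R : realType) : ln (n%:R : R) @[n --> \oo] --> +oo.
Proof.
apply/cvgryPge => M; have /cvgryPge/(_ (expR M)) := @cvgr_idn R.
apply: filterS => n Mn.
by rewrite -[M]expRK ler_ln ?posrE ?expR_gt0 // (lt_le_trans _ Mn) ?expR_gt0.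
Qed.

Lemma cvg_inv_nat_inv_ln (R : realType) :
  2 / n%:R + (1 + ln (n%:R : R))^-1 @[n --> \oo] --> (0 : R).
Proof.
rewrite -[0 in X in _ --> X](addr0 0); apply: cvgD.
  rewrite -[0 in X in _ --> X](mulr0 2); apply: cvgMr.
  apply/gtr0_cvgV0; last exact: cvgr_idn.
  by near=> n; rewrite ltr0n; near: n; exists 1%N.
apply/gtr0_cvgV0.
  near=> n; suff : 0 <= ln (n%:R : R) by move=> ?; rewrite ltr_pwDl.
  by near: n; have /cvgryPge/(_ 0) := cvg_ln_nat R.
apply/cvgryPge => M; have /cvgryPge/(_ M) := cvg_ln_nat R.
by apply: filterS => n /le_trans; apply; rewrite lerDr.
Unshelve. all: by end_near.
Qed.

Theorem theorem1 (R : realType) :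
  exists eps : nat -> R,
    (eps n @[n --> \oo] --> (0 : R)) /\
    forall n : nat, (0 < n)%N ->
      exists G : sgraph 'I_n,
        cobipartite G /\
        (* at [n = 1] the bound has denominator [log2 1 = 0] *)
        ((1 < n)%N ->
         (lcc G)%:R > 1 / 4 * (1 - eps n) * (n%:R / log2 (n%:R : R))).
Proof.
(* Since [1 - 1 / (1 + ln n) = ln n / (1 + ln n)], the second summand turns the denominator [ln n]
   into the [1 + ln n] of [lcc_lower_bound]. The summand [2 / n] absorbs the [- 1] there and makes
   the inequality strict. *)
exists (fun n => 2 / n%:R + (1 + ln (n%:R : R))^-1); split; first exact: cvg_inv_nat_inv_ln.
move=> n n0; have [G [coG bnd]] := @lcc_lower_bound R n n0.
exists G; split=> // n1.
have nR : 1 < n%:R :> R by rewrite ltr1n.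
have : 0 < ln (n%:R : R) by exact: ln_gt0.
have : 0 < ln (2 : R) by rewrite ln_gt0 // ltr1n.
move: bnd; rewrite /log2; set c := ln (2 : R); set L := ln (n%:R : R); set l := (lcc G)%:R.
move: nR; set N : R := n%:R => N1 bnd c0 L0.
have N0 : 0 < N by lra.
have LV : 0 < 1 + L by lra.
have lbnd : (N ^+ 2 - 1) * c / (4 * N * (1 + L)) <= l.
  rewrite ler_pdivrMr ?mulr_gt0 //; lra.
apply: lt_le_trans lbnd; rewrite -subr_gt0.
(* The main terms [N * c / (4 * (1 + L))] cancel; the remainder is positive because [N > 1]. *)
have -> : (N ^+ 2 - 1) * c / (4 * N * (1 + L)) -
    1 / 4 * (1 - (2 / N + (1 + L)^-1)) * (N / (L / c)) =
    c * (2 * N * (1 + L) - L) / (4 * N * L * (1 + L)).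
  by field; rewrite ?gt_eqF.
by rewrite divr_gt0 ?mulr_gt0 //; nra.
Qed.
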